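(* Let $g\in \mathcal{C}^{2}_{+}((1,\infty))$. Then: (i) for every fixed real number $\alpha\neq 0$ and (Lebesgue) almost all real numbers $\beta>1$, the sequence $$\mathbf{c}=\big(e^{2\pi i\alpha\beta^{n}g(\beta)}\big)_{n\in\mathbb{N}}$$ is a higher order oscillating sequence of order $m$ for all $m\ge 2$ (in the stronger sense); (ii) alternatively, for every fixed real number $\beta>1$ and (Lebesgue) almost all real numbers $\alpha$, the same sequence is a higher order oscillating sequence of order $m$ for all $m\ge 2$ (in the stronger sense).
   Context: $\mathbb{N}$ denotes the set of positive integers. For an interval $I\subset\mathbb{R}$ and an integer $k\ge 0$, $\mathcal{C}^{k}_{+}(I)$ is the space of all positive real-valued, $k$-times continuously differentiable functions on $I$ whose $i$-th derivative is non-negative on $I$ for all $i\le k$. A sequence $\mathbf{c}=(c_n)_{n\in\mathbb{N}}$ of complex numbers is called a higher order oscillating sequence of order $m\ge 2$ (in the stronger sense) if $\sum_{n=1}^{N}|c_n|^{\lambda}=O(N)$ for some $\lambda>1$, and $$\lim_{N\to\infty}\frac{1}{N}\sum_{n=1}^{N}c_n e^{2\pi i P(n)}=0$$ for every real polynomial $P$ of degree $\le m$. *)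

(* Defs.v *)
From HB Require Import structures.
From mathcomp Require Import all_boot all_order all_algebra.
From mathcomp Require Import complex.
From mathcomp Require Import all_classical all_reals all_analysis.

Set Implicit Arguments.
Unset Strict Implicit.
Unset Printing Implicit Defensive.

Import Order.TTheory GRing.Theory Num.Theory.
Import numFieldNormedType.Exports.

Local Open Scope classical_set_scope.
Local Open Scope ring_scope.
Local Open Scope complex_scope.

(* The class C^k_+(I). [I] must be open: the iterated derivatives [derive1n i g] are
   two-sided, so on a non-open [I] they would depend on [g] outside of [I]. *)
Definition Cplus (R : realType) (k : nat) (I : set R) (g : R -> R) : Prop :=
  [/\ forall x, I x -> 0 < g x,
      forall i x, (i < k)%N -> I x -> derivable (derive1n i g) x 1,
      forall i, (i <= k)%N -> {within I, continuous (derive1n i g)}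
    & forall i x, (i <= k)%N -> I x -> 0 <= derive1n i g x].

(* e^{2 pi i x} for real x; the library has no complex exponential. *)
Definition e2pi (R : realType) (x : R) : R[i] :=
  cos (2 * pi * x) +i* sin (2 * pi * x).

(* Sequences are indexed by the positive integers: [c 0] is never used. *)
Definition oscillating (R : realType) (m : nat) (c : nat -> R[i]) : Prop :=
  (exists2 lambda : R, 1 < lambda &
     (fun N : nat => \sum_(1 <= n < N.+1) ComplexField.Normc.normc (c n) `^ lambda : R^o)
       =O_\oo (fun N : nat => N%:R : R^o))
  /\ (forall P : {poly R}, (size P <= m.+1)%N ->
      (fun N : nat =>
         N%:R^-1 * \sum_(1 <= n < N.+1) c n * e2pi P.[n%:R] : R[i]^o)
        @ \oo --> (0 : R[i]^o)).

(* Main.v *)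
(* Multiplying by [beta ^ d - 1] is what taking the lag-[d] difference does to
   the phase [n |-> alpha * beta ^ n * g beta]. By van der Corput's inequality
   it is enough that all lag differences have vanishing Weyl means; iterating
   this removes any polynomial perturbation of the phase. Only countably many
   phases occur, namely those where [g] is replaced by its product with finitely
   many factors [beta ^ d - 1], which are again positive with nonnegative first
   two derivatives when [g] is. For each of them Koksma's argument applies: the
   oscillatory integrals of [cos (phi_n - phi_m)] decay geometrically in [n], so
   the square mean of the Weyl means of length [N] is [O(1/N)], which is summable
   along the squares; between consecutive squares the means hardly vary. *)
Require Import Defs.
From mathcomp Require Import all_boot all_order all_algebra.
From mathcomp Require Import complex.
From mathcomp Require Import all_classical all_reals all_analysis.
From mathcomp Require Import measurable_realfun zify ring lra.

Import Order.TTheory GRing.Theory Num.Theory.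
Import numFieldNormedType.Exports.

Local Open Scope classical_set_scope.
Local Open Scope ring_scope.

(** * Weyl means and their invariance under shifts *)

Definition mean {R : realType} (f : nat -> R) (N : nat) : R :=
  N%:R^-1 * \sum_(n < N) f n.

(** The real and imaginary parts of the Weyl means of [x] are kept apart, so that the analysis stays
    within real sequences. *)
Definition weyl_null {R : realType} (x : nat -> R) : Prop :=
  mean (fun n => cos (2 * pi * x n)) @ \oo --> 0 /\
  mean (fun n => sin (2 * pi * x n)) @ \oo --> 0.

(** Moving the window by one place telescopes to one new term minus one old term, a change of at
    most 2; this is done [h] times. *)
Lemma sum_shift_le {R : realType} (f : nat -> R) (h N : nat) :
  (forall n, `|f n| <= 1) ->
  `|\sum_(n < N) f (n + h)%N - \sum_(n < N) f n| <= h%:R *+ 2.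
Proof.
move=> f1; elim: h => [|h IH].
  by under eq_bigr do rewrite addn0; rewrite subrr normr0 mul0rn.
rewrite -(subrK (\sum_(n < N) f (n + h)%N) (\sum_(n < N) f (n + h.+1)%N)).
rewrite -addrA -sumrB (le_trans (ler_normD _ _))// -natr1 mulrnDl [leRHS]addrC lerD//.
under eq_bigr do rewrite addnS -addSn.
rewrite -(big_mkord xpredT (fun i => f (i.+1 + h)%N - f (i + h)%N)).
rewrite (telescope_sumr (fun i => f (i + h)%N))// (le_trans (ler_normB _ _))//.
by rewrite mulr2n lerD.
Qed.

Lemma cvg_invn {R : realType} : (fun N : nat => N%:R^-1 : R) @ \oo --> 0.
Proof. by rewrite -cvg_shiftS; exact: cvg_harmonic. Qed.

Lemma cvg_mean_shift {R : realType} (f : nat -> R) (h : nat) :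
  (forall n, `|f n| <= 1) -> mean f @ \oo --> 0 ->
  mean (fun n => f (n + h)%N) @ \oo --> 0.
Proof.
move=> f1 f0; rewrite -[X in _ --> X]addr0.
rewrite (_ : mean _ = fun N => mean f N +
   (mean (fun n => f (n + h)%N) N - mean f N)); last first.
  by apply/funext => N; rewrite addrC subrK.
apply: cvgD => //; apply: norm_cvg0.
apply: (@squeeze_cvgr _ _ _ _ (fun=> 0) (fun N => (h%:R *+ 2) * N%:R^-1)).
- near=> N; rewrite normr_ge0/= /mean -mulrBr normrM [leLHS]mulrC.
  by rewrite normfV normr_nat ler_wpM2r ?invr_ge0// sum_shift_le.
- exact: cvg_cst.
- rewrite -[X in _ --> X](mulr0 (h%:R *+ 2)); apply: cvgMl_tmp.
  exact: cvg_invn.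
Unshelve. all: by end_near. Qed.

(** * Van der Corput's inequality and difference theorem *)

Lemma sqr_sum_le {R : realType} (f : nat -> R) (N : nat) :
  (\sum_(n < N) f n) ^+ 2 <= N%:R * \sum_(n < N) f n ^+ 2.
Proof.
case: N => [|N]; first by rewrite !big_ord0 expr0n mulr0.
set S := \sum_(n < N.+1) f n; set t := S / N.+1%:R.
have S_E : S = N.+1%:R * t by rewrite mulrC divfK ?pnatr_eq0.
(* Cauchy-Schwarz comes from the nonnegativity of the variance about the average [t]. *)
have : 0 <= \sum_(n < N.+1) (f n - t) ^+ 2 by apply: sumr_ge0 => i _; exact: sqr_ge0.
under eq_bigr do rewrite sqrrB.
rewrite big_split sumrB/= sumr_const card_ord.
rewrite sumrMnl -mulr_suml -/S S_E => h.
rewrite exprMn expr2 -mulrA ler_wpM2l//.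
by move: h; rewrite -(mulr_natl (t ^+ 2)); lra.
Qed.

(** Both sides are the squared modulus of the sum of the numbers [exp (i * t h)]. *)
Lemma sqr_sum_cos_sin {R : realType} (t : nat -> R) (H : nat) :
  (\sum_(h < H) cos (t h)) ^+ 2 + (\sum_(h < H) sin (t h)) ^+ 2 =
  \sum_(h < H) \sum_(k < H) cos (t h - t k).
Proof.
rewrite !expr2 !mulr_suml -big_split/=; apply: eq_bigr => h _.
rewrite !mulr_sumr -big_split/=; apply: eq_bigr => k _.
by rewrite cosB.
Qed.

Lemma mean_sum {R : realType} (H : nat) (f : nat -> nat -> R) N :
  mean (fun n => \sum_(h < H) f h n) N = \sum_(h < H) mean (f h) N.
Proof. by rewrite /mean exchange_big/= mulr_sumr. Qed.

(* Averaging over [H] shifts costs [O(H ^ 2)] and Cauchy-Schwarz turns the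
   averaged sum into correlations. *)
Lemma vdC_inequality {R : realType} (f t : nat -> R) (H N : nat) :
  (forall n, `|f n| <= 1) ->
  (forall n, (\sum_(h < H) f (n + h)%N) ^+ 2 <=
     \sum_(h < H) \sum_(k < H) cos (t (n + h)%N - t (n + k)%N)) ->
  (H%:R * mean f N) ^+ 2 <=
    2 * \sum_(h < H) \sum_(k < H)
      mean (fun n => cos (t (n + h)%N - t (n + k)%N)) N
    + 8 * (H%:R ^+ 2 * N%:R^-1) ^+ 2.
Proof.
move=> f1 fE.
(* For [N = 0] the convention [0^-1 = 0] makes both sides vanish. *)
case: N => [|N].
  rewrite /mean invr0 mul0r mulr0 expr0n/= mulr0 expr0n/= mulr0 addr0.
  by rewrite big1 ?mulr0// => h _; rewrite big1// => k _; rewrite mul0r.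
set S := mean (fun n => \sum_(h < H) f (n + h)%N) N.+1.
have S2 : S ^+ 2 <= \sum_(h < H) \sum_(k < H)
      mean (fun n => cos (t (n + h)%N - t (n + k)%N)) N.+1.
  under eq_bigr do
    rewrite -(mean_sum _ (fun k n => cos (t (n + _)%N - t (n + k)%N))).
  rewrite -(mean_sum _
    (fun h n => \sum_(k < H) cos (t (n + h)%N - t (n + k)%N))).
  rewrite /S /mean exprMn.
  apply: (@le_trans _ _ (N.+1%:R^-1 ^+ 2 *
    (N.+1%:R * \sum_(n < N.+1) (\sum_(h < H) f (n + h)%N) ^+ 2))).
    rewrite ler_wpM2l ?sqr_ge0//.
    exact: (sqr_sum_le (fun n => \sum_(h < H) f (n + h)%N)).
  rewrite mulrA [X in X * _](_ : _ = N.+1%:R^-1); last first.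
    by rewrite expr2 mulfVK ?pnatr_eq0.
  rewrite ler_wpM2l ?invr_ge0//.
  by apply: ler_sum => n _; exact: fE.
have SE : `|S - H%:R * mean f N.+1| <= 2 * (H%:R ^+ 2 * N.+1%:R^-1).
  rewrite /S (mean_sum _ (fun h n => f (n + h)%N)) mulr_natl -[X in _ *+ X]card_ord.
  rewrite -sumr_const -sumrB (le_trans (ler_norm_sum _ _ _))//.
  apply: (@le_trans _ _ (\sum_(h < H) H%:R *+ 2 * N.+1%:R^-1)); last first.
    rewrite sumr_const card_ord -(mulr_natl (_ / _)) le_eqVlt.
    by apply/orP; left; apply/eqP; ring.
  apply: ler_sum => h _; rewrite /mean -mulrBr normrM [leLHS]mulrC.
  rewrite normfV normr_nat ler_wpM2r ?invr_ge0//.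
  rewrite (le_trans (sum_shift_le _ _ _ f1))// ler_wMn2r// ler_nat.
  exact/ltnW/ltn_ord.
(* With [X = H * mean f], what remains is [X ^ 2 <= 2 * S ^ 2 + 2 * (S - X) ^ 2], which amounts to
   [0 <= (2 * S - X) ^ 2]. *)
apply: le_trans (lerD (ler_wpM2l _ S2) (lexx _)) => //.
move: SE; set X := H%:R * _; set E := H%:R ^+ 2 * _ => SE.
have E0 : 0 <= 2 * E by exact: le_trans SE.
have := SE; rewrite -(ler_pXn2r (ltn0Sn 1)) ?nnegrE// real_normK ?num_real//.
have := sqr_ge0 (2 * S - X); lra.
Qed.

Lemma cvg_sum_ord {R : realType} {T : Type} {F : set_system T} {FF : Filter F}
    (H : nat) (f : 'I_H -> T -> R) (l : 'I_H -> R) :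
  (forall h, f h t @[t --> F] --> l h) ->
  \sum_(h < H) f h t @[t --> F] --> \sum_(h < H) l h.
Proof. by move=> fl; apply: cvg_big => [|h _]; [exact: add_continuous|]. Qed.

Lemma cvg_mean_cst {R : realType} (c : R) : mean (fun=> c) @ \oo --> c.
Proof.
apply: cvg_near_cst; exists 1%N => // -[//|N] _.
by rewrite /mean sumr_const card_ord -(mulr_natl c N.+1) mulKf ?pnatr_eq0.
Qed.

(** As cosine is even one may take [k <= h]; off the diagonal this is then the correlation of lag
    [h - k], shifted by [k]. *)
Lemma cvg_mean_correlation {R : realType} (t : nat -> R) (h k : nat) :
  (forall d, (0 < d)%N -> mean (fun n => cos (t (n + d)%N - t n)) @ \oo --> 0) ->
  mean (fun n => cos (t (n + h)%N - t (n + k)%N)) @ \oo -->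
  ((h == k)%:R : R).
Proof.
move=> t0; wlog kh : h k / (k <= h)%N => [W|].
  have [/W//|/ltnW/W] := leqP k h; rewrite eq_sym; apply: cvg_trans.
  by under eq_fun do rewrite -cosN opprB.
have [<-|hk] := eqVneq h k.
  by under eq_fun do rewrite subrr cos0; exact: cvg_mean_cst.
rewrite (_ : (fun n => _) = fun n =>
    cos (t (n + k + (h - k))%N - t (n + k)%N)); last first.
  by apply/funext => n; rewrite -addnA subnKC.
apply: (@cvg_mean_shift _ (fun n => cos (t (n + (h - k))%N - t n)) k).
  by move=> n; rewrite ler_norml cos_geN1 cos_le1.
by apply: t0; rewrite subn_gt0 ltn_neqAle eq_sym hk.
Qed.

(** Only the diagonal of the double sum survives in the limit, so that sum tends to [H] and [mean f]
    is eventually of order at most [H ^ (-1/2)], with [H] arbitrary. The second hypothesis covers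
    the cosine and the sine of [t] alike. *)
Lemma vdC_cvg {R : realType} (f t : nat -> R) :
  (forall n, `|f n| <= 1) ->
  (forall H n, (\sum_(h < H) f (n + h)%N) ^+ 2 <=
     \sum_(h < H) \sum_(k < H) cos (t (n + h)%N - t (n + k)%N)) ->
  (forall d, (0 < d)%N -> mean (fun n => cos (t (n + d)%N - t n)) @ \oo --> 0) ->
  mean f @ \oo --> 0.
Proof.
move=> f1 fE t0; apply/cvgr0Pnorm_le => e e0.
(* The 12 is [2 * 2 + 8]: the double sum will be at most [2 * H], and the error term at most
   [8 <= 8 * H]. *)
have [H H0 HE] : exists2 H : nat, (0 < H)%N & 12 <= H%:R * e ^+ 2.
  have e2 : 0 < e ^+ 2 by rewrite exprn_gt0.
  exists (Num.truncn (12 / e ^+ 2)).+1 => //.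
  by rewrite -ler_pdivrMr// ltW// truncnS_gt.
have cvgS : (fun N => \sum_(h < H) \sum_(k < H)
    mean (fun n => cos (t (n + h)%N - t (n + k)%N)) N) @ \oo --> (H%:R : R).
  rewrite (_ : H%:R = \sum_(h < H) \sum_(k < H) (h == k :> nat)%:R :> R); last first.
    rewrite -[H in LHS]card_ord -sumr_const; apply: eq_bigr => h _.
    rewrite (bigD1 h)//= eqxx big1 ?addr0// => k kh.
    by rewrite eq_sym val_eqE (negbTE kh).
  by do 2 apply: cvg_sum_ord => ?; exact: cvg_mean_correlation.
have H0' : 0 < H%:R :> R by rewrite ltr0n.
have H1 : 1 <= H%:R :> R by rewrite ler1n.
have cvgE : (fun N => H%:R ^+ 2 * N%:R^-1 : R) @ \oo --> 0.
  by rewrite -[X in _ --> X](mulr0 (H%:R ^+ 2)); apply: cvgMl_tmp; exact: cvg_invn.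
near=> N.
have SN : \sum_(h < H) \sum_(k < H)
    mean (fun n => cos (t (n + h)%N - t (n + k)%N)) N <= 2 * H%:R.
  by near: N; apply: (cvgr_le _ cvgS); lra.
have EN : `|H%:R ^+ 2 * N%:R^-1 : R| <= 1.
  by near: N; move/cvgr0Pnorm_le: cvgE; apply.
rewrite -(ler_pM2l H0') -(ler_pXn2r (ltn0Sn 1)) ?nnegrE ?mulr_ge0 ?(ltW e0)//.
rewrite exprMn real_normK ?num_real// -exprMn.
have := vdC_inequality f t H N f1 (fE H).
move=> /le_trans; apply.
have : (H%:R ^+ 2 * N%:R^-1) ^+ 2 <= 1 :> R.
  by rewrite -real_normK ?num_real// expr_le1.
have : H%:R * 12 <= H%:R * (H%:R * e ^+ 2) by rewrite ler_wpM2l.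
rewrite exprMn; move: SN; set Q := \sum_(h < H) _; set E := _ ^+ 2 * _.
rewrite expr2 -/E; lra.
Unshelve. all: by end_near. Qed.

Lemma weyl_null_vdC {R : realType} (x : nat -> R) :
  (forall d, (0 < d)%N -> weyl_null (fun n => x (n + d)%N - x n)) ->
  weyl_null x.
Proof.
move=> x0; pose t n := 2 * pi * x n.
have t0 d : (0 < d)%N -> mean (fun n => cos (t (n + d)%N - t n)) @ \oo --> 0.
  by move=> /x0[+ _]; under eq_fun do rewrite mulrBr.
have sum_sqr H n := sqr_sum_cos_sin (fun h => t (n + h)%N) H.
split; [apply: (vdC_cvg _ t) t0 => [n|H n] | apply: (vdC_cvg _ t) t0 => [n|H n]].
- by rewrite ler_norml cos_geN1 cos_le1.
- by rewrite -sum_sqr lerDl sqr_ge0.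
- by rewrite ler_norml sin_geN1 sin_le1.
- by rewrite -sum_sqr lerDr sqr_ge0.
Qed.

(** * Polynomial perturbations of the phase *)

Lemma weyl_null_addr {R : realType} (x : nat -> R) (c : R) :
  weyl_null x -> weyl_null (fun n => x n + c).
Proof.
move=> [x_cos x_sin]; split.
- rewrite (_ : mean _ = fun N =>
    mean (fun n => cos (2 * pi * x n)) N * cos (2 * pi * c) -
    mean (fun n => sin (2 * pi * x n)) N * sin (2 * pi * c)); last first.
    apply/funext => N; rewrite /mean -!(mulrA N%:R^-1) -mulrBr !mulr_suml -sumrB.
    by congr *%R; apply: eq_bigr => n _; rewrite mulrDr cosD.
  rewrite -[X in _ --> X](subr0 0) -[X in _ --> X - _](mul0r (cos (2 * pi * c))).
  rewrite -[X in _ --> _ - X](mul0r (sin (2 * pi * c))).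
  by apply: cvgB; apply: cvgMr_tmp.
- rewrite (_ : mean _ = fun N =>
    mean (fun n => sin (2 * pi * x n)) N * cos (2 * pi * c) +
    mean (fun n => cos (2 * pi * x n)) N * sin (2 * pi * c)); last first.
    apply/funext => N; rewrite /mean -!(mulrA N%:R^-1) -mulrDr !mulr_suml -big_split.
    by congr *%R; apply: eq_bigr => n _; rewrite mulrDr sinD.
  rewrite -[X in _ --> X](addr0 0) -[X in _ --> X + _](mul0r (cos (2 * pi * c))).
  rewrite -[X in _ --> _ + X](mul0r (sin (2 * pi * c))).
  by apply: cvgD; apply: cvgMr_tmp.
Qed.

(** A translation of the variable keeps the size and the leading coefficient, so the top terms
    cancel. *)
Lemma size_poly_shift_sub {R : idomainType} (p : {poly R}) (c : R) (m : nat) :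
  (size p <= m.+2)%N -> (size (p \Po ('X + c%:P) - p)%R <= m.+1)%N.
Proof.
move=> pm; have [p1|p1] := leqP (size p) 1.
  by rewrite (size1_polyC p1) comp_polyC subrr size_poly0.
rewrite -ltnS; apply: leq_trans pm.
have sz2 : (1 < size ('X + c%:P)%R)%N by rewrite size_XaddC.
have szE : size (p \Po ('X + c%:P)) = size p.
  by rewrite size_comp_poly2// size_XaddC.
have ltp : (0 < size p)%N by exact: ltn_trans p1.
rewrite -[ltnRHS](prednK ltp) ltnS; apply/leq_sizeP => j.
rewrite leq_eqVlt => /orP[/eqP<-|pj]; last first.
  rewrite coefB !nth_default ?subr0// ?szE; by rewrite (prednK ltp) in pj.
have := lead_coef_comp p sz2.
rewrite lead_coefDl ?size_polyX ?size_polyC//; last by case: (c != 0).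
rewrite lead_coefX expr1n mulr1 {1}/lead_coef szE => pE.
by rewrite coefB pE subrr.
Qed.

(** By induction on the size of [p]: a lag difference of [x + p] is one of [x], again in [S], plus a
    polynomial of smaller degree. In the end [p] is constant and merely rotates the Weyl means. *)
Lemma weyl_null_addpoly {R : realType} (S : set (nat -> R)) :
  (forall x, S x -> weyl_null x) ->
  (forall x d, (0 < d)%N -> S x -> S (fun n => x (n + d)%N - x n)) ->
  forall (p : {poly R}) x, S x -> weyl_null (fun n => x n + p.[n%:R]).
Proof.
move=> S0 SB p; have [m] := ubnP (size p).
elim: m p => [//|[|m] IH] p; rewrite ltnS => pm x Sx.
  rewrite (size1_polyC (leq_trans pm _))//.
  under eq_fun do rewrite hornerC.
  exact/weyl_null_addr/S0.
apply: weyl_null_vdC => d d0.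
rewrite (_ : (fun n => _) = fun n => (x (n + d)%N - x n) +
    (p \Po ('X + d%:R%:P) - p).[n%:R]).
  apply: IH; last exact: SB.
  case: m pm => [|m] pm.
    by rewrite (size1_polyC pm) comp_polyC subrr size_poly0.
  by rewrite ltnS size_poly_shift_sub.
apply/funext => n; rewrite hornerD hornerN horner_comp hornerD hornerX hornerC.
by rewrite -natrD; ring.
Qed.

(** * An oscillatory integral *)

Lemma is_derive_continuous {R : realType} (f : R -> R) (x df : R) :
  is_derive x 1 f df -> {for x, continuous f}.
Proof. by move=> [fx _]; exact/differentiable_continuous/derivable1_diffP. Qed.

Lemma continuous_itv_within {R : realType} (f : R -> R) (a b : R) :
  {in `[a, b], forall x : R, {for x, continuous f}} ->
  {within `[a, b], continuous f}.
Proof. by move=> fc; apply: continuous_in_subspaceT => x /set_mem; exact: fc. Qed.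

(* [cos phi <= ((sin phi - 1) / phi')'] as soon as [phi''] is nonnegative. *)
Lemma integral_cos_le {R : realType} (a b : R) (phi phi1 phi2 : R -> R) :
  a < b ->
  {in `[a, b], forall x : R, is_derive x 1 phi (phi1 x)} ->
  {in `[a, b], forall x : R, is_derive x 1 phi1 (phi2 x)} ->
  {in `[a, b], forall x : R, {for x, continuous phi2}} ->
  {in `[a, b], forall x : R, 0 < phi1 x} ->
  {in `[a, b], forall x : R, 0 <= phi2 x} ->
  (\int[lebesgue_measure]_(x in `[a, b]) (cos (phi x))%:E <= (2 / phi1 a)%:E)%E.
Proof.
move=> ab dphi dphi1 cphi2 phi1_gt0 phi2_ge0.
(* Subtracting 1 from the sine makes the extra term of the derivative [w] nonnegative and gives
   [W b <= 0]; the integral is thus at most [- W a <= 2 / phi1 a]. *)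
pose W x := (sin (phi x) - 1) * (phi1 x)^-1.
pose w x := cos (phi x) + (1 - sin (phi x)) * (phi2 x / phi1 x / phi1 x).
have aab : a \in `[a, b] by rewrite in_itv/= lexx ltW.
have bab : b \in `[a, b] by rewrite in_itv/= lexx ltW.
have dW x : x \in `[a, b] -> is_derive x 1 W (w x).
  move=> xab; have := dphi x xab; have := dphi1 x xab => ? ?.
  have p0 : phi1 x != 0 by rewrite gt_eqF// phi1_gt0.
  have dsin : is_derive x 1 (fun x => sin (phi x)) (cos (phi x) * phi1 x).
    exact: (@is_derive1_comp _ sin phi).
  have dinv : is_derive x 1 (fun x => (phi1 x)^-1) (- (phi1 x) ^- 2 * phi2 x).
    exact: is_deriveV.
  apply: (@is_derive_eq _ _ _ W x 1 _ _
    (is_deriveM (is_deriveB dsin (is_derive_cst (1 : R) x 1)) dinv)).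
  rewrite /w /GRing.scale/=.
  rewrite (_ : (_ - cst 1) x = sin (phi x) - 1)//.
  by field.
have cphi x : x \in `[a, b] -> {for x, continuous phi}.
  by move=> /dphi; exact: is_derive_continuous.
have cphi1 x : x \in `[a, b] -> {for x, continuous phi1}.
  by move=> /dphi1; exact: is_derive_continuous.
have ccos x : x \in `[a, b] -> {for x, continuous (fun x => cos (phi x))}.
  by move=> /cphi; move=> c; apply: continuous_comp => //; exact: continuous_cos.
have cw x : x \in `[a, b] -> {for x, continuous w}.
  move=> xab; apply: continuousD; first exact: ccos.
  apply: continuousM.
    apply: continuousB; first exact: cvg_cst.
    by apply: continuous_comp; [exact: cphi | exact: continuous_sin].
  have cV : {for x, continuous (fun x => (phi1 x)^-1)}.
    by apply: continuousV; [rewrite gt_eqF// phi1_gt0|exact: cphi1].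
  by apply: continuousM => //; apply: continuousM => //; exact: cphi2.
apply: (@le_trans _ _ (\int[lebesgue_measure]_(x in `[a, b]) (w x)%:E)%E).
  apply: le_integral => //=.
  - apply: continuous_compact_integrable; first exact: segment_compact.
    exact: continuous_itv_within.
  - apply: continuous_compact_integrable; first exact: segment_compact.
    exact: continuous_itv_within.
  - move=> x /set_mem xab; rewrite lee_fin lerDl mulr_ge0 ?subr_ge0 ?sin_le1//.
    by rewrite !divr_ge0 ?phi2_ge0// ltW// phi1_gt0.
rewrite (@continuous_FTC2 _ w W)//.
- rewrite -EFinB lee_fin /W.
  have : (sin (phi b) - 1) / phi1 b <= 0.
    by rewrite pmulr_lle0 ?invr_gt0 ?phi1_gt0// subr_le0 sin_le1.
  have : (-2) / phi1 a <= (sin (phi a) - 1) / phi1 a.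
    rewrite ler_pM2r ?invr_gt0 ?phi1_gt0//; have := sin_geN1 (phi a); lra.
  lra.
- exact: continuous_itv_within.
- have cW x : x \in `[a, b] -> {for x, continuous W}.
    by move=> /dW; exact: is_derive_continuous.
  have [ _ Wa Wb] := (continuous_within_itvP _ ab).1 (continuous_itv_within _ _ _ cW).
  by split => // x xab; have [] := dW x (subset_itv_oo_cc xab).
- by move=> x xab; have [_ <-] := dW x (subset_itv_oo_cc xab); rewrite derive1E.
Qed.

(** * From square lengths to all lengths *)

Lemma sqrt_bracket (N : nat) : exists k : nat, (k ^ 2 <= N < k.+1 ^ 2)%N.
Proof.
elim: N => [|N [k /andP[kN Nk]]]; first by exists 0%N.
have [h|h] := leqP (k.+1 ^ 2) N.+1; last by exists k; rewrite h leqW.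
by exists k.+1; rewrite h /=; nia.
Qed.

(** The sum is cut at [M]: the first part is dominated by the mean of length [M], and each of the
    other [N - M] terms is at most 1. *)
Lemma norm_mean_le {R : realType} (f : nat -> R) (M N : nat) :
  (forall n, `|f n| <= 1) -> (0 < M <= N)%N ->
  `|mean f N| <= `|mean f M| + (N - M)%N%:R / M%:R.
Proof.
move=> f1 /andP[M0 MN]; have N0 : (0 < N)%N by exact: leq_trans MN.
rewrite {1}/mean -(subnKC MN) big_split_ord/= (subnKC MN) mulrDr.
apply: le_trans (ler_normD _ _) _; apply: lerD; rewrite !normrM !normfV !normr_nat.
  by rewrite ler_wpM2r// lef_pV2 ?posrE ?ltr0n// ler_nat.
rewrite mulrC; apply: ler_pM; rewrite ?invr_ge0//; last first.
  by rewrite lef_pV2 ?posrE ?ltr0n// ler_nat.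
apply: le_trans (ler_norm_sum _ _ _) _.
apply: le_trans (ler_sum _ (fun i _ => f1 _)) _.
by rewrite sumr_const card_ord.
Qed.

(** Between [k.+1 ^ 2] and the next square there are at most [2 * k.+1] further terms, which cost at
    most [2 / k.+1]. *)
Lemma cvg_mean_squares {R : realType} (f : nat -> R) :
  (forall n, `|f n| <= 1) ->
  (fun k => mean f (k.+1 ^ 2)%N) @ \oo --> 0 -> mean f @ \oo --> 0.
Proof.
move=> f1 /cvgr0Pnorm_le fk; apply/cvgr0Pnorm_le => e e0.
have e2 : 0 < e / 2 by rewrite divr_gt0.
have [K1 _ K1P] := fk _ e2.
have [K2 _ K2P] : \forall k \near \oo, `|2 * @harmonic R k| <= e / 2.
  move: (e / 2) e2; apply/(cvgr0Pnorm_le (F := \oo)).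
  rewrite -[X in _ --> X](mulr0 2); apply: cvgMl_tmp; exact: cvg_harmonic.
exists ((maxn K1 K2).+2 ^ 2)%N => // N /= KN.
have [[|k] /andP[kN Nk]] := sqrt_bracket N; first by nia.
have Kk : (maxn K1 K2 <= k)%N by nia.
have := K1P k (leq_trans (leq_maxl _ _) Kk).
have := K2P k (leq_trans (leq_maxr _ _) Kk).
rewrite ger0_norm ?mulr_ge0 ?invr_ge0// => h2 h1.
apply: le_trans (norm_mean_le f (k.+1 ^ 2) N f1 _) _; first by rewrite kN; nia.
have h3 : (N - k.+1 ^ 2)%N%:R / (k.+1 ^ 2)%N%:R <= 2 * k.+1%:R^-1 :> R.
  rewrite ler_pdivrMr ?ltr0n; last by nia.
  rewrite natrX expr2 -mulrA mulKf ?pnatr_eq0//.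
  by rewrite -[leRHS]natrM ler_nat; nia.
apply: le_trans (lerD h1 (le_trans h3 h2)) _.
by rewrite -splitr.
Qed.

(** * Second moments of the Weyl means *)

Lemma sum_inv_squares_le {R : realFieldType} (n : nat) :
  \sum_(0 <= k < n) (k.+1 ^ 2)%N%:R^-1 <= 2 :> R.
Proof.
(* The sharper bound is inductive because [1 / y ^ 2 <= 2 / y - 2 / (y + 1)] for [y >= 1]. *)
suff : \sum_(0 <= k < n) (k.+1 ^ 2)%N%:R^-1 <= 2 - 2 * n.+1%:R^-1 :> R.
  by move=> /le_trans; apply; rewrite lerBlDr lerDl mulr_ge0 ?invr_ge0.
elim: n => [|n IH]; first by rewrite big_nil invr1 mulr1 subrr.
rewrite big_nat_recr//= (le_trans (lerD IH (lexx _)))// natrX -(natr1 n.+1).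
have : 1 <= n.+1%:R :> R by rewrite ler1n.
move: n.+1%:R => y y1.
rewrite -subr_ge0 [leRHS](_ : _ = (y - 1) / (y ^+ 2 * (y + 1))).
  by rewrite divr_ge0 ?subr_ge0// mulr_ge0 ?sqr_ge0//; lra.
by field; apply/andP; split; lra.
Qed.

Lemma sum_geometric_le {R : realFieldType} (r : R) (n : nat) :
  0 <= r < 1 -> \sum_(k < n) r ^+ k <= (1 - r)^-1.
Proof.
move=> /andP[r0 r1]; have r1' : 0 < 1 - r by rewrite subr_gt0.
rewrite -(ler_pM2l r1') divff ?gt_eqF// -opprB mulNr -subrX1 opprB.
by rewrite lerBlDr lerDl exprn_ge0.
Qed.

(** This is the squared modulus of the complex Weyl mean. *)
Definition energy {R : realType} (x : nat -> R) (N : nat) : R :=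
  mean (fun n => cos (2 * pi * x n)) N ^+ 2 +
  mean (fun n => sin (2 * pi * x n)) N ^+ 2.

Lemma energyE {R : realType} (x : nat -> R) (N : nat) :
  energy x N = N%:R^-1 ^+ 2 *
    \sum_(h < N) \sum_(k < N) cos (2 * pi * (x h - x k)).
Proof.
rewrite /energy /mean !exprMn -mulrDr.
rewrite (sqr_sum_cos_sin (fun n => 2 * pi * x n)).
by under eq_bigr do under eq_bigr do rewrite -mulrBr.
Qed.

Lemma energy_ge0 {R : realType} (x : nat -> R) (N : nat) : 0 <= energy x N.
Proof. by rewrite addr_ge0 ?sqr_ge0. Qed.

Lemma cvg_energy_squares {R : realType} (x : nat -> R) :
  (fun k => energy x (k.+1 ^ 2)%N) @ \oo --> 0 -> weyl_null x.
Proof.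
move=> x0; have sqr_cvg0 (u : nat -> R) :
    (forall k, u k ^+ 2 <= energy x (k.+1 ^ 2)) -> u @ \oo --> 0.
  move=> uE; apply/cvgr0Pnorm_le => e e0.
  have e2 : 0 < e ^+ 2 by rewrite exprn_gt0.
  have /cvgr0Pnorm_le/(_ _ e2) xe := x0.
  near=> k.
  rewrite -(ler_pXn2r (ltn0Sn 1)) ?nnegrE ?(ltW e0)//.
  rewrite real_normK ?num_real// (le_trans (uE k))//.
  by rewrite -(ger0_norm (energy_ge0 _ _)); near: k; exact: xe.
split; apply: cvg_mean_squares.
- by move=> n; rewrite ler_norml cos_geN1 cos_le1.
- by apply: sqr_cvg0 => k; rewrite lerDl sqr_ge0.
- by move=> n; rewrite ler_norml sin_geN1 sin_le1.
- by apply: sqr_cvg0 => k; rewrite lerDr sqr_ge0.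
Unshelve. all: by end_near. Qed.

Lemma continuous_itv_integrable {R : realType} (a b : R) (f : R -> R) :
  {in `[a, b], forall x : R, {for x, continuous f}} ->
  (@lebesgue_measure R).-integrable `[a, b] (EFin \o f).
Proof.
move=> fc; apply: continuous_compact_integrable; first exact: segment_compact.
exact: continuous_itv_within.
Qed.

(** The series of the [f k] has a finite integral, hence is finite almost everywhere, and the terms
    of a convergent series tend to 0. *)
Lemma ae_summable_cvg0 {R : realType} d (T : measurableType d)
    (mu : {measure set T -> \bar R}) (D : set T) (f : nat -> T -> R) (C : R) :
  measurable D -> (forall k, measurable_fun D (f k)) ->
  (forall k x, D x -> 0 <= f k x) ->
  (forall n, \sum_(0 <= k < n) \int[mu]_(x in D) (f k x)%:E <= C%:E)%E ->
  {ae mu, forall x, D x -> (fun k => f k x) @ \oo --> (0 : R)}.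
Proof.
move=> mD mf f0 fC.
have mf' k : measurable_fun D (fun x => (f k x)%:E).
    exact/measurable_EFinP.
have f0' k x : D x -> (0 <= (f k x)%:E)%E by move=> Dx; rewrite lee_fin f0.
have sum_int : mu.-integrable D (fun x => \sum_(0 <= k <oo) (f k x)%:E)%E.
  apply/integrableP; split.
    by apply: ge0_emeasurable_sum => // k x Dx _; exact: f0'.
  apply: (@le_lt_trans _ _ C%:E); last by rewrite ltry.
  rewrite (eq_integral (fun x => \sum_(0 <= k <oo) (f k x)%:E)%E); last first.
    move=> x /set_mem Dx; rewrite gee0_abs//.
    by apply: nneseries_ge0 => k _ _; exact: f0'.
  rewrite integral_nneseries//; apply: lime_le.
    by apply: is_cvg_nneseries => k _ _; apply: integral_ge0 => x; exact: f0'.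
  by apply: nearW => n; exact: fC.
have := integrable_ae mD sum_int; apply: filterS => x fin_x Dx.
apply: cvg_series_cvg_0; apply: nnseries_is_cvg => [k|]; first exact: f0.
by move: (fin_x Dx); rewrite ge0_fin_numE// nneseries_ge0// => k _ _; exact: f0'.
Qed.

Lemma continuous_cos_phase {R : realType} (y : R -> R) (b : R) :
  {for b, continuous y} -> {for b, continuous (fun b => cos (2 * pi * y b))}.
Proof.
move=> yc; apply: (continuous_comp (g := cos)); last exact: continuous_cos.
by apply: continuousM => //; exact: cvg_cst.
Qed.

Section second_moment.
Context {R : realType} (a b : R) (x : nat -> R -> R) (K r : R).
Hypotheses (ab : a < b) (K0 : 0 <= K) (r01 : 0 <= r < 1).
Hypothesis x_cont :
  forall n, {in `[a, b], forall y : R, {for y, continuous (x n)}}.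
Hypothesis x_le : forall m n, (m < n)%N ->
  (\int[lebesgue_measure]_(y in `[a, b]) (cos (2 * pi * (x n y - x m y)))%:E
     <= (K * r ^+ n)%:E)%E.
Let mu : measure _ _ := @lebesgue_measure R.
Let C : R := (b - a) + 2 * K * (1 - r)^-1.

Lemma cos_diff_continuous h k : {in `[a, b], forall y : R,
  {for y, continuous (fun y => cos (2 * pi * (x h y - x k y)))}}.
Proof.
move=> y yab; apply: continuous_cos_phase.
by apply: continuousB; exact: x_cont.
Qed.

Lemma energy_continuous N : {in `[a, b], forall y : R,
  {for y, continuous (fun y => energy (x^~ y) N)}}.
Proof.
move=> y yab; rewrite (_ : (fun y => _) = fun y => N%:R^-1 ^+ 2 *
  \sum_(h < N) \sum_(k < N) cos (2 * pi * (x h y - x k y))); last first.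
  by apply/funext => z; rewrite energyE.
apply: continuousM; first exact: cvg_cst.
by do 2 apply: cvg_sum_ord => ?; exact: cos_diff_continuous.
Qed.

(** Off the diagonal only the power with the larger index is needed; adding the other one gives a
    symmetric bound that is easy to sum. *)
Lemma integral_cos_diff_le h k :
  (\int[mu]_(y in `[a, b]) (cos (2 * pi * (x h y - x k y)))%:E <=
   ((h == k)%:R * (b - a) + K * r ^+ h + K * r ^+ k)%:E)%E.
Proof.
have /andP[r0 _] := r01.
have rK n : 0 <= K * r ^+ n by rewrite mulr_ge0 ?exprn_ge0.
have ba : 0 <= b - a by rewrite subr_ge0 ltW.
have [hk|kh|<-] := ltngtP h k.
- under eq_integral do rewrite -cosN -mulrN opprB.
  by apply: le_trans (x_le _ _ hk) _; rewrite lee_fin mul0r add0r lerDr.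
- by apply: le_trans (x_le _ _ kh) _; rewrite lee_fin mul0r add0r lerDl.
- under eq_integral do rewrite subrr mulr0 cos0.
  rewrite integral_cst//= lebesgue_measure_itv/= lte_fin ab mul1e -EFinB.
  by rewrite lee_fin mul1r -addrA lerDl addr_ge0.
Qed.

(** The diagonal contributes [N.+1 * (b - a)] and the geometric terms at most
    [2 * K * N.+1 / (1 - r)]; the energy divides this by [N.+1 ^ 2]. *)
Lemma integral_energy_le N :
  (\int[mu]_(y in `[a, b]) (energy (x^~ y) N.+1)%:E <= (C * N.+1%:R^-1)%:E)%E.
Proof.
have ccos h k := cos_diff_continuous h k.
under eq_integral do rewrite energyE EFinM.
rewrite integralZl//=; last first.
  apply: continuous_itv_integrable => y yab.
  by do 2 apply: cvg_sum_ord => ?; exact: ccos.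
under eq_integral do rewrite -sumEFin.
rewrite integral_sum//=; last first.
  move=> h; apply: continuous_itv_integrable => y yab.
  by apply: cvg_sum_ord => ?; exact: ccos.
apply: (@le_trans _ _ ((N.+1%:R^-1 ^+ 2)%:E * \sum_(h < N.+1) \sum_(k < N.+1)
    ((h == k :> nat)%:R * (b - a) + K * r ^+ h + K * r ^+ k)%:E)%E).
  apply: lee_wpmul2l; first by rewrite lee_fin sqr_ge0.
  apply: lee_sum => h _; under eq_integral do rewrite -sumEFin.
  rewrite integral_sum//=; last first.
    by move=> k; apply: continuous_itv_integrable; exact: ccos.
  by apply: lee_sum => k _; exact: integral_cos_diff_le.
under eq_bigr do rewrite sumEFin; rewrite sumEFin -EFinM lee_fin.
have -> : \sum_(h < N.+1) \sum_(k < N.+1)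
    ((h == k :> nat)%:R * (b - a) + K * r ^+ h + K * r ^+ k) =
  N.+1%:R * (b - a) + 2 * K * N.+1%:R * \sum_(k < N.+1) r ^+ k.
  set G := \sum_(k < N.+1) r ^+ k.
  transitivity (\sum_(h < N.+1) ((b - a) + K * G + N.+1%:R * K * r ^+ h)).
    apply: eq_bigr => h _; rewrite 2!big_split/= -mulr_suml -!mulr_sumr -/G.
    rewrite sumr_const card_ord -(mulr_natl (r ^+ _) N.+1) (bigD1 h)//= eqxx.
    rewrite big1 ?addr0 ?mulr1n; first by ring.
    by move=> k kh; rewrite eq_sym val_eqE (negbTE kh).
  rewrite big_split/= -mulr_sumr -/G sumr_const card_ord -(mulr_natl (_ + _) N.+1).
  by ring.
rewrite /C [leRHS](_ : _ = N.+1%:R^-1 ^+ 2 *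
  (N.+1%:R * (b - a) + 2 * K * N.+1%:R * (1 - r)^-1)).
  rewrite ler_wpM2l ?sqr_ge0// lerD2l ler_wpM2l ?mulr_ge0//.
  exact: sum_geometric_le.
have /andP[r0 r1] := r01.
by field; rewrite subr_eq0 gt_eqF//= addrC natr1 pnatr_eq0.
Qed.

(** Along the squares the energies have integrals at most [C / k.+1 ^ 2], with sum at most [2 * C],
    so they tend to 0 almost everywhere. *)
Lemma ae_weyl_null :
  {ae mu, forall y, y \in `[a, b] -> weyl_null (x^~ y)}.
Proof.
have C0 : 0 <= C.
  have /andP[r0 r1] := r01.
  by rewrite addr_ge0 ?subr_ge0 ?(ltW ab)// !mulr_ge0 ?invr_ge0 ?subr_ge0 ?(ltW r1).
apply: (filterS _ (@ae_summable_cvg0 _ _ _ mu `[a, b]%classic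
    (fun k y => energy (x^~ y) (k.+1 ^ 2)%N) (C * 2) _ _ _ _)) => //.
- by move=> y xy yab; apply: cvg_energy_squares; exact: xy.
- move=> k; apply: subspace_continuous_measurable_fun => //.
  exact/continuous_itv_within/energy_continuous.
- by move=> k y _; exact: energy_ge0.
- move=> n; apply: (@le_trans _ _
      (\sum_(0 <= k < n) (C * (k.+1 ^ 2)%N%:R^-1)%:E)%E).
    apply: lee_sum => k _; rewrite -[(k.+1 ^ 2)%N]prednK ?expn_gt0//.
    exact: integral_energy_le.
  by rewrite sumEFin lee_fin -mulr_sumr ler_wpM2l// sum_inv_squares_le.
Qed.

End second_moment.

(** * Positive functions with nonnegative first two derivatives *)

Definition jet2 {R : realType} (u u1 u2 : R -> R) : Prop :=
  forall x : R, 1 < x ->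
    [/\ is_derive x 1 u (u1 x), is_derive x 1 u1 (u2 x),
        {for x, continuous u2} & [/\ 0 < u x, 0 <= u1 x & 0 <= u2 x]].

(** The derivatives become explicit functions, ready for the product rule; as the ray is open,
    continuity within it is continuity at each of its points. *)
Lemma jet2_Cplus {R : realType} (g : R -> R) :
  Cplus 2 `]1, +oo[ g -> jet2 g (derive1n 1 g) (derive1n 2 g).
Proof.
move=> [g0 dg cg ge0] x x1.
have xI : `]1, +oo[%classic x by rewrite /= in_itv/= x1.
split; last split; last exact: (ge0 2%N x).
- by split; [exact: (dg 0%N x) | exact/esym/derive1E].
- by split; [exact: (dg 1%N x) | exact/esym/derive1E].
- by have := cg 2%N isT; rewrite continuous_open_subspace//; apply; rewrite inE.
- exact: g0.
- exact: (ge0 1%N x).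
Qed.

Lemma jet2_cst {R : realType} (c : R) : 0 < c -> jet2 (cst c) (cst 0) (cst 0).
Proof.
by move=> c0 x _; split => //; [exact: is_derive_cst..|exact: cvg_cst].
Qed.

(** By the Leibniz rule all terms are products of nonnegative factors. This closure allows lag
    factors to be absorbed into [g]. *)
Lemma jet2M {R : realType} (u u1 u2 v v1 v2 : R -> R) :
  jet2 u u1 u2 -> jet2 v v1 v2 ->
  jet2 (fun x => u x * v x) (fun x => u1 x * v x + u x * v1 x)
    (fun x => (u2 x * v x + u1 x * v1 x) + (u1 x * v1 x + u x * v2 x)).
Proof.
move=> ju jv x x1.
have [du du1 cu2 [u_gt0 u1_ge0 u2_ge0]] := ju x x1.
have [dv dv1 cv2 [v_gt0 v1_ge0 v2_ge0]] := jv x x1.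
have [cu cu1] := (is_derive_continuous _ _ _ du, is_derive_continuous _ _ _ du1).
have [cv cv1] := (is_derive_continuous _ _ _ dv, is_derive_continuous _ _ _ dv1).
split.
- apply: (is_derive_eq (is_deriveM du dv)).
  by rewrite /GRing.scale/=; ring.
- apply: (is_derive_eq (is_deriveD (is_deriveM du1 dv) (is_deriveM du dv1))).
  by rewrite /GRing.scale/=; ring.
- by apply: continuousD; apply: continuousD; apply: continuousM.
- have [u0 v0] := (ltW u_gt0, ltW v_gt0).
  by rewrite mulr_gt0 ?addr_ge0 ?mulr_ge0.
Qed.

Lemma jet2_horner {R : realType} (p : {poly R}) :
  (forall x, 1 < x -> [/\ 0 < p.[x], 0 <= p^`().[x] & 0 <= p^`()^`().[x]]) ->
  jet2 (horner p) (horner p^`()) (horner p^`()^`()).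
Proof.
move=> p_ge0 x x1; split; last exact: p_ge0.
- exact: is_derive_poly.
- exact: is_derive_poly.
- exact: continuous_horner.
Qed.

(** For [x > 1] both the powers of [x] and the coefficients produced by differentiation grow with
    the exponent. *)
Lemma jet2_subXn {R : realType} (m n : nat) (p := 'X^n - 'X^m : {poly R}) :
  (m < n)%N -> jet2 (horner p) (horner p^`()) (horner p^`()^`()).
Proof.
move=> mn; apply: jet2_horner => x x1.
have le_powMn i j k l : (i <= j)%N -> (k <= l)%N ->
    x ^+ i *+ k <= x ^+ j *+ l.
  move=> ij kl; apply: (@le_trans _ _ (x ^+ j *+ k)).
    by apply: ler_wMn2r; rewrite ler_eXn2l.
  by apply: ler_wpMn2l => //; rewrite exprn_ge0// ltW// (lt_trans ltr01).
rewrite /p !derivB !derivXn !derivMn !derivXn !hornerD !hornerN !hornerMn !hornerXn.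
rewrite !subr_ge0 subr_gt0 ltr_eXn2l//; split => //.
- by apply: le_powMn; lia.
- by rewrite -!mulrnA; apply: le_powMn; [lia|apply: leq_mul; lia].
Qed.

(** * Koksma's argument for the exponential phases *)

Lemma ae_imp d (T : measurableType d) {R : realType}
    (mu : {measure set T -> \bar R}) (P Q : T -> Prop) :
  (forall x, P x -> Q x) ->
  {ae mu, forall x, P x} -> {ae mu, forall x, Q x}.
Proof. by move=> PQ; apply: filterS. Qed.

Lemma ae_forall_count d (T : measurableType d) {R : realType}
    (mu : {measure set T -> \bar R}) (I : countType) (P : I -> T -> Prop) :
  (forall i, {ae mu, forall x, P i x}) -> {ae mu, forall x, forall i, P i x}.
Proof.
move=> aeP; pose Q n x := if unpickle n is Some i then P i x else True.
have aeQ : {ae mu, forall x, forall n, Q n x}.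
  apply: ae_foralln => n; rewrite /Q; case: unpickle => [i|]; first exact: aeP.
  exact: aeW.
by apply: ae_imp aeQ => x Qx i; have := Qx (pickle i); rewrite /Q pickleK.
Qed.

(** Since [x ^ m <= x ^ n], the derivative is at least [(n - m) * x ^ n]. *)
Lemma deriv_subXn_ge {R : realType} (m n : nat) (x : R)
    (p := 'X^(n.+1) - 'X^(m.+1) : {poly R}) :
  (m < n)%N -> 1 < x -> x ^+ n <= p^`().[x].
Proof.
move=> mn x1; have x_ge0 k : 0 <= x ^+ k.
  by rewrite exprn_ge0// ltW// (lt_trans ltr01).
rewrite /p derivB !derivXn hornerD hornerN !hornerMn !hornerXn/= lerBrDr.
apply: (@le_trans _ _ (x ^+ n + x ^+ n *+ m.+1)).
  by rewrite lerD2l; apply: ler_wMn2r; rewrite ler_eXn2l// ltnW.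
by rewrite -mulrS; apply: ler_wpMn2l.
Qed.

Lemma cos_norm {R : realType} (x : R) : cos `|x| = cos x.
Proof. by case: (ler0P x) => _ //; rewrite cosN. Qed.

(** Up to sign, the difference of two phases is a function [u] with [u1 a >= c * a ^ n * G a]. The
    oscillatory integral is thus at most [2 / (c * G a) * a ^- n], which dictates the constant and
    the ratio of the second moment bound. *)
Lemma ae_weyl_null_base_itv {R : realType} (G G1 G2 : R -> R) (alpha a b : R) :
  jet2 G G1 G2 -> alpha != 0 -> 1 < a -> a < b ->
  {ae lebesgue_measure, forall beta : R, beta \in `[a, b] ->
     weyl_null (fun n => alpha * beta ^+ n.+1 * G beta)}.
Proof.
move=> jG alpha0 a1 ab.
have gt1 x : x \in `[a, b] -> 1 < x.
  by rewrite in_itv/= => /andP[ax _]; exact: lt_le_trans ax.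
have a0 : 0 < a by exact: lt_trans ltr01 a1.
have aab : a \in `[a, b] by rewrite in_itv/= lexx ltW.
have pi0 := pi_gt0 R.
pose c : R := 2 * pi * `|alpha|.
have c0 : 0 < c by rewrite !mulr_gt0 ?normr_gt0.
have Ga : 0 < G a by have [_ _ _ []] := jG a a1.
apply: (@ae_weyl_null _ a b (fun n beta => alpha * beta ^+ n.+1 * G beta)
    (2 / (c * G a)) a^-1) => //.
- by rewrite divr_ge0// ltW// mulr_gt0.
- by rewrite invr_ge0 ltW//= invf_lt1.
- move=> n x xab; have [dG _ _ _] := jG x (gt1 _ xab).
  apply: continuousM; last exact: is_derive_continuous dG.
  by apply: continuousM; [exact: cvg_cst|exact: exprn_continuous].
move=> m n mn.
have := jet2M _ _ _ _ _ _ (jet2_cst c c0)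
  (jet2M _ _ _ _ _ _ (jet2_subXn m.+1 n.+1 mn) jG).
set u := fun x => cst c x * _; set u1 := fun x => cst 0 x * _ + _.
set u2 := (X in jet2 _ _ X) => ju.
have u1_ge x : 1 < x -> c * x ^+ n * G x <= u1 x.
  move=> x1; have [_ _ _ [Gx G1x _]] := jG x x1.
  have [_ _ _ [px _ _]] := jet2_subXn m.+1 n.+1 mn x x1.
  rewrite /u1 /cst mul0r add0r -mulrA ler_wpM2l ?(ltW c0)//.
  rewrite (le_trans (ler_wpM2r (ltW Gx) (deriv_subXn_ge m n x mn x1)))//.
  by rewrite lerDl mulr_ge0// ltW.
have u1_gt0 x : 1 < x -> 0 < u1 x.
  move=> x1; apply: lt_le_trans (u1_ge x x1).
  have [_ _ _ [Gx _ _]] := jG x x1.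
  have xn : 0 < x ^+ n by rewrite exprn_gt0// (lt_trans ltr01).
  exact: mulr_gt0 (mulr_gt0 c0 xn) Gx.
(* Evenness of the cosine replaces [alpha] by its absolute value, which makes the phase
   increasing. *)
have cosE y : y \in `[a, b] ->
    cos (2 * pi * (alpha * y ^+ n.+1 * G y - alpha * y ^+ m.+1 * G y)) =
    cos (u y).
  move=> /gt1 y1; have [_ _ _ [uy _ _]] := ju y y1.
  rewrite -[in LHS]cos_norm -[u y]ger0_norm ?(ltW uy)//; congr cos.
  have -> : u y = 2 * pi * (`|alpha| * ((y ^+ n.+1 - y ^+ m.+1) * G y)).
    by rewrite /u /cst !hornerE; ring.
  have -> : alpha * y ^+ n.+1 * G y - alpha * y ^+ m.+1 * G y =
    alpha * ((y ^+ n.+1 - y ^+ m.+1) * G y) by ring.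
  by rewrite !normrM normr_id.
under eq_integral => y /set_mem/= yab do rewrite (cosE y yab).
apply: le_trans (integral_cos_le a b u u1 u2 ab _ _ _ _ _) _.
- by move=> x /gt1/ju[].
- by move=> x /gt1/ju[].
- by move=> x /gt1/ju[].
- by move=> x /gt1; exact: u1_gt0.
- by move=> x /gt1/ju[_ _ _ []].
rewrite lee_fin exprVn -mulrA -invfM ler_wpM2l// lef_pV2 ?posrE ?u1_gt0//.
  by rewrite mulrAC u1_ge.
exact: mulr_gt0 (mulr_gt0 c0 Ga) (exprn_gt0 n a0).
Qed.

Lemma ae_weyl_null_base {R : realType} (G G1 G2 : R -> R) (alpha : R) :
  jet2 G G1 G2 -> alpha != 0 ->
  {ae lebesgue_measure, forall beta : R, 1 < beta ->
     weyl_null (fun n => alpha * beta ^+ n.+1 * G beta)}.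
Proof.
move=> jG alpha0.
(* Countably many compact intervals exhaust the ray; the 3 keeps the one for [k = 0]
   nondegenerate. *)
have : {ae lebesgue_measure, forall beta : R, forall k : nat,
    beta \in `[1 + k.+1%:R^-1, 3 + k%:R] ->
    weyl_null (fun n => alpha * beta ^+ n.+1 * G beta)}.
  apply: ae_forall_count => k; apply: ae_weyl_null_base_itv jG _ _ _ => //.
    by rewrite ltrDl invr_gt0 ltr0n.
  have : k.+1%:R^-1 <= 1 :> R by rewrite invf_le1 ?ler1n ?ltr0n.
  have : 0 <= k%:R :> R by [].
  by move: (k.+1%:R^-1) => t; lra.
apply: ae_imp => beta betaP beta1.
have beta1' : 0 < beta - 1 by rewrite subr_gt0.
pose k1 := Num.truncn beta; pose k2 := Num.truncn (beta - 1)^-1.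
apply: (betaP (k1 + k2)%N); rewrite in_itv/=; apply/andP; split.
  rewrite -lerBrDl -[leRHS]invrK lef_pV2 ?posrE ?invr_gt0 ?ltr0n//.
  rewrite (le_trans (ltW (truncnS_gt _)))// ler_nat ltnS leq_addl//.
rewrite (le_trans (ltW (truncnS_gt _)))// -/k1 natrD -natr1.
have : 0 <= k2%:R :> R by [].
lra.
Qed.

Lemma ae_weyl_null_scale {R : realType} (beta c : R) :
  1 < beta -> 0 < c ->
  {ae lebesgue_measure, forall alpha : R,
     weyl_null (fun n => alpha * beta ^+ n.+1 * c)}.
Proof.
move=> beta1 c0; have beta0 : 0 < beta by exact: lt_trans ltr01 beta1.
have : {ae lebesgue_measure, forall alpha : R, forall k : nat,
    alpha \in `[- k.+1%:R, k.+1%:R] ->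
    weyl_null (fun n => alpha * beta ^+ n.+1 * c)}.
  apply: ae_forall_count => k.
  have ab : - k.+1%:R < k.+1%:R :> R.
    by rewrite (@lt_trans _ _ 0) ?oppr_lt0 ?ltr0n.
  (* The phase is linear in [alpha], with slope [d]; as [m < n], [beta ^ n.+1 - beta ^ m.+1 >= (beta
     - 1) * beta ^ n]. *)
  pose C : R := 2 * pi * c * (beta - 1).
  have C0 : 0 < C by rewrite !mulr_gt0 ?subr_gt0 ?pi_gt0.
  apply: (@ae_weyl_null _ (- k.+1%:R) k.+1%:R
    (fun n alpha => alpha * beta ^+ n.+1 * c) (2 / C) beta^-1) => //.
  - by rewrite divr_ge0// ltW.
  - by rewrite invr_ge0 ltW//= invf_lt1.
  - move=> n x _; apply: continuousM; last exact: cvg_cst.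
    by apply: continuousM; [exact: cvg_id|exact: cvg_cst].
  move=> m n mn; pose d : R := 2 * pi * c * (beta ^+ n.+1 - beta ^+ m.+1).
  have Cd : C * beta ^+ n <= d.
    rewrite /C /d -mulrA ler_wpM2l ?mulr_ge0 ?pi_ge0 ?(ltW c0)//.
    by rewrite mulrBl mul1r -exprS lerD2l lerN2 ler_eXn2l.
  have d0 : 0 < d by apply: lt_le_trans Cd; rewrite mulr_gt0// exprn_gt0.
  have cosE y : cos (2 * pi * (y * beta ^+ n.+1 * c - y * beta ^+ m.+1 * c)) =
      cos (d * y) by congr cos; rewrite /d; ring.
  under eq_integral do rewrite cosE.
  apply: le_trans
    (integral_cos_le _ _ ( *%R d) (cst d) (cst 0) ab _ _ _ _ _) _ => //.
  - move=> x _; apply: is_derive_eq; by rewrite /GRing.scale/= mulr1.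
  - by move=> x _; exact: is_derive_cst.
  - by move=> x _; exact: cvg_cst.
  rewrite lee_fin exprVn -mulrA -invfM ler_wpM2l// lef_pV2 ?posrE//.
  by rewrite mulr_gt0// exprn_gt0.
apply: ae_imp => alpha alphaP; apply: (alphaP (Num.truncn `|alpha|)).
by rewrite in_itv/= -ler_norml ltW// truncnS_gt.
Qed.

(** * Products of lag factors *)

Definition lag_prod {R : realType} (beta : R) (hs : seq nat) : R :=
  \prod_(h <- hs) (beta ^+ h.+1 - 1).

(** An entry [h] stands for the lag [h.+1], so all lags are positive and every factor exceeds 0. *)
Lemma lag_prod_gt0 {R : realType} (beta : R) hs :
  1 < beta -> 0 < lag_prod beta hs.
Proof.
move=> beta1; rewrite /lag_prod; apply: prodr_gt0 => h _.
by rewrite subr_gt0 exprn_egt1.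
Qed.

Lemma jet2_lag_prod {R : realType} (g g1 g2 : R -> R) (hs : seq nat) :
  jet2 g g1 g2 -> exists G1 G2, jet2 (fun x => g x * lag_prod x hs) G1 G2.
Proof.
move=> jg; elim: hs => [|h hs [G1 [G2 IH]]].
  exists g1, g2; rewrite (_ : (fun x => _) = g)//.
  by apply/funext => x; rewrite /lag_prod big_nil mulr1.
do 2 eexists; rewrite (_ : (fun x => _) = fun x =>
  (horner ('X^(h.+1) - 'X^0)) x * (g x * lag_prod x hs)); last first.
  apply/funext => x; rewrite /lag_prod big_cons hornerD hornerN !hornerXn expr0.
  by rewrite mulrCA.
exact: jet2M (jet2_subXn 0 h.+1 _) IH.
Qed.

(* The lag-[d] difference of [C * beta ^ n.+1] is a sequence of the same shape,
   with [C] multiplied by [beta ^ d - 1]. *)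
Lemma weyl_null_expn_addpoly {R : realType} (beta C : R) (p : {poly R}) :
  (forall hs, weyl_null (fun n => C * lag_prod beta hs * beta ^+ n.+1)) ->
  weyl_null (fun n => C * beta ^+ n.+1 + p.[n%:R]).
Proof.
move=> C0; pose S := [set x : nat -> R |
  exists hs, x = fun n => C * lag_prod beta hs * beta ^+ n.+1].
apply: (weyl_null_addpoly S) => [x [hs ->]//|x d d0 [hs ->]|].
  exists (d.-1 :: hs); apply/funext => n.
  by rewrite /lag_prod big_cons prednK// -addSn exprD; ring.
by exists [::]; apply/funext => n; rewrite /lag_prod big_nil mulr1.
Qed.

(** * Return to complex sequences and conclusion *)

Lemma normc_e2pi {R : realType} (x : R) :
  ComplexField.Normc.normc (e2pi x) = 1.
Proof. by rewrite /= cos2Dsin2 sqrtr1. Qed.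

Lemma e2piD {R : realType} (x y : R) : e2pi (x + y) = e2pi x * e2pi y.
Proof.
rewrite /e2pi mulrDr cosD sinD; apply/eqP; rewrite eq_complex /=.
by rewrite eqxx addrC eqxx.
Qed.

Lemma mean_e2piE {R : realType} (y : nat -> R) (N : nat) :
  N%:R^-1 * \sum_(n < N) e2pi (y n) =
  Complex (mean (fun n => cos (2 * pi * y n)) N)
    (mean (fun n => sin (2 * pi * y n)) N).
Proof.
have -> : \sum_(n < N) e2pi (y n) = Complex (\sum_(n < N) cos (2 * pi * y n))
    (\sum_(n < N) sin (2 * pi * y n)).
  by elim/big_rec3: _ => // i x1 x2 x3 _ ->.
rewrite -(rmorph_nat (real_complex R)) -fmorphV /mean.
by apply/eqP; rewrite eq_complex/= !mul0r subr0 addr0 !eqxx.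
Qed.

Lemma normC_le {R : realType} (x y : R) : `|Complex x y| <= (`|x| + `|y|)%:C%C.
Proof.
rewrite normc_def/= lecR -(ler_pXn2r (ltn0Sn 1)) ?nnegrE ?sqrtr_ge0 ?addr_ge0//.
rewrite sqr_sqrtr ?addr_ge0 ?sqr_ge0// sqrrD !real_normK ?num_real//.
by rewrite addrAC lerDl mulrn_wge0 ?mulr_ge0.
Qed.

(** All terms have modulus 1, so the growth condition holds with exponent 2; the rest is a change of
    index. *)
Lemma oscillating_weyl_null {R : realType} (m : nat) (x : nat -> R) :
  (forall p : {poly R}, weyl_null (fun n => x n.+1 + p.[n%:R])) ->
  oscillating m (fun n => e2pi (x n)).
Proof.
move=> x0; split.
  exists 2; first by rewrite ltr1n.
  rewrite (_ : (fun N => _) = fun N => N%:R); last first.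
    apply/funext => N; under eq_bigr do rewrite normc_e2pi powR1.
    by rewrite big_const_nat subn1 iter_addr_0.
  by apply/eqO_exP; exists 1 => //; apply: nearW => N; rewrite mul1r.
(* Summation from 1 becomes summation from 0, and [q] is [p] translated by 1 to compensate. *)
move=> p _; pose q := p \Po ('X + 1%:P).
have [x_cos x_sin] := x0 q.
(* A positive complex number has zero imaginary part, so the tolerance is real. *)
apply/cvgr0Pnorm_le => -[e e'] /=; rewrite ltcE/= => /andP[/eqP-> e0].
have e2 : 0 < e / 2 by rewrite divr_gt0.
near=> N.
have -> : \sum_(1 <= n < N.+1) e2pi (x n) * e2pi p.[n%:R] =
    \sum_(n < N) e2pi (x n.+1 + q.[n%:R]).
  rewrite big_add1 big_mkord; apply: eq_bigr => n _; rewrite -e2piD.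
  by rewrite /q horner_comp !hornerE natr1.
rewrite [X in `|X|](mean_e2piE (fun n => x n.+1 + q.[n%:R]) N).
apply: le_trans (normC_le _ _) _.
rewrite lecR [leRHS]splitr lerD//; near: N.
  by move/cvgr0Pnorm_le : x_cos; exact.
by move/cvgr0Pnorm_le : x_sin; exact.
Unshelve. all: by end_near. Qed.

Theorem corollary2 (R : realType) (g : R -> R)
    (hg : Cplus 2 `]1, +oo[ g) :
  (forall alpha : R, alpha != 0 ->
     {ae lebesgue_measure, forall beta : R, 1 < beta ->
        forall m : nat, (2 <= m)%N ->
          oscillating m (fun n => e2pi (alpha * beta ^+ n * g beta))})
  /\
  (forall beta : R, 1 < beta ->
     {ae lebesgue_measure, forall alpha : R,
        forall m : nat, (2 <= m)%N ->
          oscillating m (fun n => e2pi (alpha * beta ^+ n * g beta))}).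
Proof.
have jg := jet2_Cplus g hg; split => [alpha alpha0|beta beta1].
  (* The lists of lags are countable, so one null set serves for all of them. *)
  have : {ae lebesgue_measure, forall beta : R, forall hs, 1 < beta ->
      weyl_null (fun n => alpha * beta ^+ n.+1 * (g beta * lag_prod beta hs))}.
    apply: ae_forall_count => hs.
    have [G1 [G2 jG]] := jet2_lag_prod g _ _ hs jg.
    exact: ae_weyl_null_base jG alpha0.
  apply: ae_imp => beta null_beta beta1 m _; apply: oscillating_weyl_null => p.
  under eq_fun do rewrite mulrAC; apply: weyl_null_expn_addpoly => hs.
  by have := null_beta hs beta1; congr weyl_null; apply/funext => n; ring.
(* With [beta] fixed, [g beta * lag_prod beta hs] is a positive constant and the phase is linear in
   [alpha]. *)
have : {ae lebesgue_measure, forall alpha : R, forall hs,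
    weyl_null (fun n => alpha * beta ^+ n.+1 * (g beta * lag_prod beta hs))}.
  apply: ae_forall_count => hs; apply: ae_weyl_null_scale => //.
  rewrite mulr_gt0 ?lag_prod_gt0//.
  by have [_ _ _ []] := jg beta beta1.
apply: ae_imp => alpha null_alpha m _; apply: oscillating_weyl_null => p.
under eq_fun do rewrite mulrAC; apply: weyl_null_expn_addpoly => hs.
by have := null_alpha hs; congr weyl_null; apply/funext => n; ring.
Qed.
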